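(* Let $x,y\in\mathbb{Q}$ with $x\ne0$. Let $\alpha\in\mathbb{Q}_p$ be given by an infinite Ruban or Browkin I continued fraction expansion $\alpha=[a_0,a_1,a_2,\dots]$, where $v_p(a_0)\le0$ and $v_p(a_n)<0$ for all $n\ge1$. Define $x_0=x$, $y_0=y$ and $x_{n+1}=x_na_n+y_n$, $y_{n+1}=x_n$ for $n\ge0$. If $$v_p(x_{n+1})\ge v_p(x_n)+1\quad\text{for all } n\ge0,$$ then $x\alpha+y=0$, that is, $\alpha=-\frac yx$.
   Context: $p$ is a prime and $v_p$ is the $p$-adic valuation on $\mathbb{Q}_p$, with $v_p(0)=+\infty$. Fix a digit set: either $\{0,\dots,p-1\}$ (Ruban) or, for $p$ odd, $\{-\frac{p-1}{2},\dots,\frac{p-1}{2}\}$ (Browkin I). For $\alpha=\sum_{n\ge -r}c_np^n\in\mathbb{Q}_p$ with $c_n$ in the digit set, the floor is $\lfloor\alpha\rfloor_p=\sum_{n=-r}^{0}c_np^n$ (equal to $0$ if $r<0$). The corresponding continued fraction expansion $[a_0,a_1,\dots]$ of $\alpha$ is given by $\alpha_0=\alpha$, $a_n=\lfloor\alpha_n\rfloor_p$, $\alpha_{n+1}=\frac1{\alpha_n-a_n}$; it is infinite if $\alpha_n\neq a_n$ for all $n$. *)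

(* Defs.v *)
From HB Require Import structures.
From mathcomp Require Import all_boot all_order all_algebra.
From mathcomp Require Import generic_quotient ring_quotient.
From mathcomp Require Import boolp classical_sets functions constructive_ereal.
From mathcomp Require Import zify ring lra.

Set Implicit Arguments.
Unset Strict Implicit.
Unset Printing Implicit Defensive.

Import Order.TTheory GRing.Theory Num.Theory.

Local Open Scope ring_scope.

Definition rat_val (p : nat) (q : rat) : \bar int :=
  if q == 0 then +oo%E
  else ((logn p `|numq q|)%:Z - (logn p `|denq q|)%:Z)%:E.

Section RatVal.
Variables (p : nat) (p_pr : prime p).
Implicit Types (q r : rat) (M : int).

Lemma rat_val0 : rat_val p 0 = +oo%E.
Proof. by rewrite /rat_val eqxx. Qed.

Lemma rat_valE (m n : int) : m != 0 -> n != 0 ->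
  rat_val p (m%:~R / n%:~R) = ((logn p `|m|)%:Z - (logn p `|n|)%:Z)%:E.
Proof.
move=> m0 n0; rewrite /rat_val mulf_eq0 invr_eq0 !intr_eq0 (negPf m0) (negPf n0).
set q := _ / _; congr EFin.
have q0 : q != 0 by rewrite mulf_neq0 ?invr_eq0 ?intr_eq0.
have E : (numq q * n = m * denq q)%R.
  apply: (@intr_inj rat); rewrite !intrM.
  have dq0 : (denq q)%:~R != 0 :> rat by rewrite intr_eq0 denq_neq0.
  have nq0 : n%:~R != 0 :> rat by rewrite intr_eq0.
  by apply/eqP; rewrite -eqr_div // divq_num_den.
have := congr1 (fun z => logn p `|z|%N) E.
rewrite !abszM !lognM ?absz_gt0 ?numq_eq0 ?denq_neq0 //; lia.
Qed.

Lemma rat_val_neq0 q : q != 0 -> exists v : int, rat_val p q = v%:E.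
Proof. by move=> /negPf q0; rewrite /rat_val q0; eexists. Qed.

Lemma rat_val_eq0 q : (rat_val p q == +oo%E) = (q == 0).
Proof. by rewrite /rat_val; case: ifP. Qed.

Lemma rat_val_neNy q : rat_val p q != -oo%E.
Proof. by rewrite /rat_val; case: ifP. Qed.

Lemma rat_val1 : rat_val p 1 = 0%E.
Proof. by rewrite /rat_val oner_eq0 /= logn1. Qed.

Lemma rat_valN q : rat_val p (- q) = rat_val p q.
Proof. by rewrite /rat_val oppr_eq0 numqN denqN abszN. Qed.

Lemma rat_valM q r : rat_val p (q * r) = (rat_val p q + rat_val p r)%E.
Proof.
have [->|q0] := eqVneq q 0.
  by rewrite mul0r rat_val0; case: (rat_val p r) (rat_val_neNy r).
have [->|r0] := eqVneq r 0.
  by rewrite mulr0 rat_val0; case: (rat_val p q) (rat_val_neNy q).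
rewrite -{1}(divq_num_den q) -{1}(divq_num_den r) mulf_div -!intrM rat_valE;
  rewrite ?mulf_neq0 ?numq_eq0 ?denq_neq0 //.
rewrite /rat_val (negPf q0) (negPf r0) -EFinD !abszM.
rewrite !lognM ?absz_gt0 ?numq_eq0 ?denq_neq0 //; congr EFin; lia.
Qed.

Lemma rat_valV q (v : int) : rat_val p q = v%:E -> rat_val p q^-1 = (- v)%:E.
Proof.
move=> qv; have q0 : q != 0 by rewrite -rat_val_eq0 qv.
have := rat_valM q q^-1; rewrite mulfV // rat_val1 qv.
have [w ->] : exists w : int, rat_val p q^-1 = w%:E.
  by apply: rat_val_neq0; rewrite invr_eq0.
by rewrite -EFinD => -[vw]; congr EFin; lia.
Qed.

Lemma rat_valD q r M :
  (M%:E <= rat_val p q)%E -> (M%:E <= rat_val p r)%E ->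
  (M%:E <= rat_val p (q + r))%E.
Proof.
have [->|q0] := eqVneq q 0; first by rewrite add0r.
have [->|r0] := eqVneq r 0; first by rewrite addr0.
have [->|s0] := eqVneq (q + r) 0; first by rewrite rat_val0 leey.
have dn (z : rat) : (denq z)%:~R != 0 :> rat by rewrite intr_eq0 denq_neq0.
have E : q + r = (numq q * denq r + numq r * denq q)%:~R / (denq q * denq r)%:~R.
  by rewrite -{1}(divq_num_den q) -{1}(divq_num_den r) addf_div // intrD !intrM.
have n0 : numq q * denq r + numq r * denq q != 0.
  by apply: contra_neq s0; rewrite E => ->; rewrite mul0r.
rewrite E rat_valE ?mulf_neq0 ?denq_neq0 //.
rewrite /rat_val (negPf q0) (negPf r0) !lee_fin abszM.
rewrite lognM ?absz_gt0 ?denq_neq0 // => Mq Mr.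
set a := numq q * _ in n0 *; set b := numq r * _ in n0 *.
suff : (minn (logn p (absz a)) (logn p (absz b)) <= logn p (absz (a + b)%R))%N.
  rewrite /a /b !abszM !lognM ?absz_gt0 ?numq_eq0 ?denq_neq0 //; lia.
have a0 : a != 0 by rewrite mulf_neq0 ?numq_eq0 ?denq_neq0.
have b0 : b != 0 by rewrite mulf_neq0 ?numq_eq0 ?denq_neq0.
rewrite -pfactor_dvdn ?absz_gt0 // -[(_ ^ _)%N]absz_nat -dvdzE.
by apply: rpredD; rewrite dvdzE absz_nat pfactor_dvdn ?absz_gt0 ?geq_minl ?geq_minr.
Qed.

Lemma rat_valB q r M :
  (M%:E <= rat_val p q)%E -> (M%:E <= rat_val p r)%E ->
  (M%:E <= rat_val p (q - r))%E.
Proof. by move=> ? ?; apply: rat_valD; rewrite ?rat_valN. Qed.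

Lemma rat_val_eq q r (v : int) : rat_val p q = v%:E ->
  ((v + 1)%:E <= rat_val p (r - q))%E -> rat_val p r = v%:E.
Proof.
move=> qv h; have r_ge : (v%:E <= rat_val p r)%E.
  rewrite -(subrK q r); apply: rat_valD; last by rewrite qv.
  by apply: le_trans h; rewrite lee_fin lerDl.
apply/eqP; rewrite eq_le r_ge andbT leNgt; apply/negP => r_gt.
suff : ((v + 1)%:E <= rat_val p q)%E by rewrite qv lee_fin; lia.
rewrite (_ : q = r - (r - q)); last by ring.
apply: rat_valB h; move: r_gt; case: (rat_val p r) => [w| |//].
  by rewrite lte_fin lee_fin lezD1.
by rewrite leey.
Qed.

End RatVal.

Section Cauchy.
Variable p : nat.

Definition rat_cauchy (u : nat -> rat) : Prop :=
  forall M : int, exists N : nat, forall m n : nat,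
    (N <= m)%N -> (N <= n)%N -> (M%:E <= rat_val p (u m - u n))%E.

Definition rat_null (u : nat -> rat) : Prop :=
  forall M : int, exists N : nat, forall n : nat,
    (N <= n)%N -> (M%:E <= rat_val p (u n))%E.

End Cauchy.

Definition cauchy_pred (p : nat) (p_pr : prime p) : pred (nat -> rat) :=
  fun u => `[< rat_cauchy p u >].

Section CauchyRing.
Variables (p : nat) (p_pr : prime p).
Implicit Types u v : nat -> rat.

Lemma rat_cauchy_bounded u : rat_cauchy p u ->
  exists (B : int) (N : nat), forall n, (N <= n)%N -> (B%:E <= rat_val p (u n))%E.
Proof.
move=> /(_ 0) [N uN].
have [B BN] : exists B : int, (B%:E <= rat_val p (u N))%E /\ (B <= 0).
  have [->|/(rat_val_neq0 p) [v ->]] := eqVneq (u N) 0.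
    by exists 0; rewrite rat_val0 leey.
  by exists (Num.min v 0); rewrite lee_fin; lia.
exists B, N => n Nn; rewrite -(subrK (u N) (u n)).
case: BN => BN B0; apply: (rat_valD p_pr) => //.
by apply: le_trans (uN _ _ Nn (leqnn N)); rewrite lee_fin.
Qed.

Lemma cauchy_subring : subring_closed (cauchy_pred p_pr).
Proof.
split.
- by apply/asboolP => M; exists 0%N => m n _ _; rewrite subrr rat_val0 leey.
- move=> u v /asboolP uC /asboolP vC; apply/asboolP => M.
  have [N uN] := uC M; have [N' vN] := vC M; exists (maxn N N') => m n.
  rewrite !geq_max => /andP[? ?] /andP[? ?].
  rewrite (_ : _ - _ = (u m - u n) - (v m - v n)); last first.
    by change (u m - v m - (u n - v n) = u m - u n - (v m - v n)); ring.
  by apply: (rat_valB p_pr); [apply: uN | apply: vN].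
- move=> u v /asboolP uC /asboolP vC; apply/asboolP => M.
  have [B [K uK]] := rat_cauchy_bounded uC.
  have [B' [K' vK]] := rat_cauchy_bounded vC.
  have [N uN] := uC (M - B'); have [N' vN] := vC (M - B).
  exists (maxn (maxn K K') (maxn N N')) => m n.
  rewrite !geq_max => /andP[/andP[? ?] /andP[? ?]] /andP[/andP[? ?] /andP[? ?]].
  rewrite (_ : _ - _ = (u m - u n) * v m + u n * (v m - v n)); last first.
    by change (u m * v m - u n * v n = (u m - u n) * v m + u n * (v m - v n)); ring.
  apply: (rat_valD p_pr); rewrite (rat_valM p_pr).
    by rewrite -(subrK B' M) EFinD leeD ?uN ?vK.
  by rewrite -(subrKC B M) EFinD leeD ?vN ?uK.
Qed.

HB.instance Definition _ :=
  GRing.isSubringClosed.Build (nat -> rat) (cauchy_pred p_pr) cauchy_subring.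

End CauchyRing.

Definition cauchy_seq (p : nat) (p_pr : prime p) : Type :=
  {u : nat -> rat | u \in cauchy_pred p_pr}.

HB.instance Definition _ p (p_pr : prime p) := SubChoice.on (cauchy_seq p_pr).
HB.instance Definition _ p (p_pr : prime p) :=
  [SubChoice_isSubComNzRing of cauchy_seq p_pr by <:].

Definition null_pred (p : nat) (p_pr : prime p) : pred (cauchy_seq p_pr) :=
  fun u => `[< rat_null p (\val u) >].

Section NullIdeal.
Variables (p : nat) (p_pr : prime p).

Lemma null_idealr : idealr_closed (@null_pred p p_pr).
Proof.
split.
- by apply/asboolP => M; exists 0%N => n _; rewrite rat_val0 leey.
- apply/negP => /asboolP /(_ 1)[N /(_ N (leqnn N))].
  by rewrite -[\val _ _]/(1 : rat) rat_val1.
- move=> a u v /asboolP uN /asboolP vN; apply/asboolP => M.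
  have [B [K aK]] := rat_cauchy_bounded p_pr (asboolW (valP a)).
  have [N uB] := uN (M - B); have [N' vB] := vN M.
  exists (maxn K (maxn N N')) => n; rewrite !geq_max => /and3P[? ? ?].
  rewrite -[\val _ _]/(\val a n * \val u n + \val v n).
  apply: (rat_valD p_pr); last exact: vB.
  by rewrite (rat_valM p_pr) -(subrKC B M) EFinD leeD ?uB ?aK.
Qed.

HB.instance Definition _ := isIdealr.Build (cauchy_seq p_pr) (@null_pred p p_pr)
  null_idealr.

Definition null_ideal : idealr (cauchy_seq p_pr) := @null_pred p p_pr.

End NullIdeal.

(* The field Q_p: the completion of Q for the p-adic valuation, i.e. rational
   Cauchy sequences modulo null sequences. The primality proof is a parameter of
   the type so that the field structure can be inferred. *)
Definition padic (p : nat) (p_pr : prime p) : Type :=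
  {ideal_quot (null_ideal p_pr)}.

Section PadicField.
Variables (p : nat) (p_pr : prime p).

HB.instance Definition _ := GRing.ComNzRing.on (padic p_pr).
HB.instance Definition _ := Quotient.on (padic p_pr).

Local Open Scope quotient_scope.

Lemma pi_eqP (u v : cauchy_seq p_pr) :
  reflect (rat_null p (\val (u - v))) (\pi_(padic p_pr) u == \pi_(padic p_pr) v).
Proof.
have -> : (\pi_(padic p_pr) u == \pi_(padic p_pr) v) = null_pred (u - v).
  by rewrite -[RHS]/(u - v \in (null_ideal p_pr : pred _)) Quotient.idealrBE.
exact: asboolP.
Qed.

Lemma pi_eq0P (u : cauchy_seq p_pr) :
  reflect (rat_null p (\val u)) (\pi_(padic p_pr) u == 0).
Proof.
rewrite -(rmorph0 (\pi_(padic p_pr))) -[X in rat_null _ (\val X)]subr0.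
exact: pi_eqP.
Qed.

Lemma cauchy_val_cst (u : nat -> rat) : rat_cauchy p u -> ~ rat_null p u ->
  exists (v : int) (N : nat), forall n, (N <= n)%N -> rat_val p (u n) = v%:E.
Proof.
move=> uC unull.
have [M hM] : exists M : int, forall N, exists2 n, (N <= n)%N & (rat_val p (u n) < M%:E)%E.
  apply: contrapT => h; apply: unull => M; apply: contrapT => h'; apply: h; exists M => N.
  apply: contrapT => h''; apply: h'; exists N => n Nn; rewrite leNgt; apply/negP => ?.
  by apply: h''; exists n.
have [N uN] := uC M; have [k Nk uk] := hM N.
have [v kv] : exists v : int, rat_val p (u k) = v%:E.
  apply: rat_val_neq0; apply/eqP => u0; move: uk; rewrite u0 rat_val0.
  by rewrite ltNge leey.
exists v, N => n Nn; apply: (rat_val_eq p_pr kv).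
apply: le_trans (uN _ _ Nn Nk); rewrite lee_fin lezD1.
by rewrite -lte_fin -kv.
Qed.

Lemma cauchy_inv (u : nat -> rat) : rat_cauchy p u -> ~ rat_null p u ->
  rat_cauchy p (fun n => (u n)^-1).
Proof.
move=> uC unull M; have [v [N uv]] := cauchy_val_cst uC unull.
have [K uK] := uC (M + v + v); exists (maxn N K) => m n.
rewrite !geq_max => /andP[Nm Km] /andP[Nn Kn].
have un0 k : (N <= k)%N -> u k != 0.
  by move=> /uv kv; rewrite -(rat_val_eq0 p) kv.
rewrite (_ : _ - _ = (u n - u m) * ((u m)^-1 * (u n)^-1)); last first.
  by field; rewrite !un0.
rewrite !(rat_valM p_pr) (rat_valV p_pr (uv _ Nm)) (rat_valV p_pr (uv _ Nn)).
rewrite (_ : M = (M + v + v) + (- v + - v)); last by ring.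
by rewrite !(EFinD _ (- v + - v)) leeD // uK.
Qed.

Definition cauchy_seq_inv (u : cauchy_seq p_pr) : cauchy_seq p_pr :=
  insubd 0 (fun n => (\val u n)^-1).

Definition padic_inv (x : padic p_pr) : padic p_pr :=
  if x == 0 then 0 else \pi_(padic p_pr) (cauchy_seq_inv (repr x)).

Lemma padic_mulVf (x : padic p_pr) : x != 0 -> padic_inv x * x = 1.
Proof.
move=> x0; rewrite /padic_inv (negPf x0).
have xC : rat_cauchy p (\val (repr x)) := asboolW (valP (repr x)).
have xN : ~ rat_null p (\val (repr x)).
  by move=> /pi_eq0P; rewrite reprK; apply/negP.
have [v [N uv]] := cauchy_val_cst xC xN.
rewrite -[X in _ * X]reprK -rmorphM -(rmorph1 (\pi_(padic p_pr))).
apply/eqP/pi_eqP => M; exists N => n Nn.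
rewrite rmorphB rmorphM rmorph1 /= insubdK; last exact/asboolP/cauchy_inv.
rewrite -[X in rat_val _ X]/((\val (repr x) n)^-1 * \val (repr x) n - 1).
rewrite mulVf ?subrr ?rat_val0 ?leey //.
by rewrite -(rat_val_eq0 p) uv.
Qed.

Lemma padic_inv0 : padic_inv 0 = 0.
Proof. by rewrite /padic_inv eqxx. Qed.

HB.instance Definition _ :=
  GRing.ComNzRing_isField.Build (padic p_pr) padic_mulVf padic_inv0.

End PadicField.

Section PadicVal.
Variables (p : nat) (p_pr : prime p).
Local Open Scope quotient_scope.

Lemma cauchy_cst (q : rat) : (fun=> q) \in cauchy_pred p_pr.
Proof.
by apply/asboolP => M; exists 0%N => m n _ _; rewrite subrr rat_val0 leey.
Qed.

Definition padic_of_rat (q : rat) : padic p_pr :=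
  \pi_(padic p_pr) (Sub (fun=> q) (cauchy_cst q) : cauchy_seq p_pr).

Lemma padic_of_rat_zmod : zmod_morphism padic_of_rat.
Proof. by move=> q r; rewrite -rmorphB; congr (\pi_(padic p_pr) _); apply: val_inj. Qed.

Lemma padic_of_rat_monoid : monoid_morphism padic_of_rat.
Proof.
split=> [|q r]; first by rewrite -(rmorph1 (\pi_(padic p_pr))); congr (\pi_(padic p_pr) _); apply: val_inj.
by rewrite -rmorphM; congr (\pi_(padic p_pr) _); apply: val_inj.
Qed.

HB.instance Definition _ :=
  GRing.isZmodMorphism.Build rat (padic p_pr) padic_of_rat padic_of_rat_zmod.
HB.instance Definition _ :=
  GRing.isMonoidMorphism.Build rat (padic p_pr) padic_of_rat padic_of_rat_monoid.

(* The valuations of a Cauchy sequence that is not null are eventually constant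
   and this constant is the valuation of its class. For a null sequence no finite
   constant is possible, so the default value +oo applies to 0. *)
Definition padic_val (x : padic p_pr) : \bar int :=
  xget +oo%E [set e | exists N : nat, forall n : nat,
    (N <= n)%N -> rat_val p (\val (repr x) n) = e].

Lemma padic_val0 : padic_val 0 = +oo%E.
Proof.
rewrite /padic_val; case: xgetP => // e _ [N uN].
have : rat_null p (\val (repr (0 : padic p_pr))) by apply/pi_eq0P; rewrite reprK.
case: e uN => [v uN|//|uN _].
  move=> /(_ (v + 1))[K /(_ _ (leq_maxr N K))].
  by rewrite (uN _ (leq_maxl N K)) lee_fin lezD1 ltxx.
by have := uN _ (leqnn N); move/eqP; rewrite (negPf (rat_val_neNy _ _)).
Qed.

Lemma padic_val_pi (u : cauchy_seq p_pr) (v : int) (N : nat) :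
  (forall n, (N <= n)%N -> rat_val p (\val u n) = v%:E) ->
  padic_val (\pi_(padic p_pr) u) = v%:E.
Proof.
move=> uv.
have /pi_eqP/(_ (v + 1))[K uK] : \pi_(padic p_pr) (repr (\pi_(padic p_pr) u)) ==
  \pi_(padic p_pr) u by rewrite reprK.
have ru n : (maxn N K <= n)%N -> rat_val p (\val (repr (\pi_(padic p_pr) u)) n) = v%:E.
  rewrite geq_max => /andP[Nn Kn]; apply: (rat_val_eq p_pr (uv _ Nn)).
  exact: (uK _ Kn).
rewrite /padic_val; case: xgetP => [e _ [N' eN']|/(_ v%:E)]; last first.
  by case; exists (maxn N K).
by rewrite -(eN' _ (leq_maxl N' (maxn N K))) ru // leq_maxr.
Qed.

Lemma padic_val_rat (q : rat) : padic_val (padic_of_rat q) = rat_val p q.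
Proof.
have [->|/(rat_val_neq0 p)[v qv]] := eqVneq q 0.
  by rewrite rmorph0 padic_val0 rat_val0.
by rewrite qv; apply: (@padic_val_pi _ v 0%N).
Qed.

Definition padic_cvg (s : nat -> padic p_pr) (x : padic p_pr) : Prop :=
  forall M : int, exists N : nat, forall m : nat,
    (N <= m)%N -> (M%:E <= padic_val (x - s m)%R)%E.

End PadicVal.

Variant digit_system := Ruban | BrowkinI.

(* The Browkin digits are a residue system only for p odd. *)
Definition digits (p : nat) (D : digit_system) : pred int :=
  match D with
  | Ruban => [pred c : int | 0 <= c < p%:Z]
  | BrowkinI => [pred c : int | - (p.-1./2)%:Z <= c <= (p.-1./2)%:Z]
  end.

(* \sum_(-r <= n <= m) c_n p^n with n = k - r; it is 0 when m < - r. *)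
Definition digit_sum (p : nat) (c : int -> int) (r m : int) : rat :=
  \sum_(k < absz (Num.max 0 (m + r + 1)))
    (c (k%:Z - r))%:~R * p%:R ^ (k%:Z - r).

Definition is_expansion (p : nat) (p_pr : prime p) (D : digit_system)
    (alpha : padic p_pr) (c : int -> int) (r : int) : Prop :=
  (forall n : int, - r <= n -> digits p D (c n)) /\
  padic_cvg (fun m : nat => padic_of_rat p_pr (digit_sum p c r m%:Z)) alpha.

(* The floor as a functional relation: the digits form a complete residue system,
   so c is unique up to leading zeros, which do not change the sum. *)
Definition is_floor (p : nat) (p_pr : prime p) (D : digit_system)
    (alpha : padic p_pr) (q : rat) : Prop :=
  exists (c : int -> int) (r : int),
    is_expansion D alpha c r /\ q = digit_sum p c r 0.

Definition infinite_cf_expansion (p : nat) (p_pr : prime p) (D : digit_system)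
    (alpha : padic p_pr) (a : nat -> rat) : Prop :=
  exists al : nat -> padic p_pr,
    [/\ al 0%N = alpha,
        forall n, is_floor D (al n) (a n),
        forall n, al n != padic_of_rat p_pr (a n) &
        forall n, al n.+1 = (al n - padic_of_rat p_pr (a n))^-1].

(* Main.v *)
(* With z_n = x_n alpha_n + y_n and d_n = alpha_n - a_n, the recursions give
   z_n = x_{n+1} + x_n d_n = z_{n+1} d_n. The floor satisfies v(d_n) >= 1 and the
   hypothesis gives v(x_n) >= v(x) + n, so v(z_n) >= v(x) + n + 1 and
   z_0 = z_n d_0 ... d_{n-1} has arbitrarily large valuation, hence vanishes. *)
Require Import Defs.
From mathcomp Require Import all_boot all_order all_algebra.
From mathcomp Require Import generic_quotient boolp.
From mathcomp Require Import constructive_ereal.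
From mathcomp Require Import zify ring.
Import Order.TTheory GRing.Theory Num.Theory.
Local Open Scope ring_scope.

Section PadicValTheory.
Set Implicit Arguments.
Unset Strict Implicit.
Variables (p : nat) (p_pr : prime p).
Local Open Scope quotient_scope.
Implicit Types (x y : padic p_pr) (M : int).

(** Lower bounds can be read off any representative: for null [u] both sides hold, and otherwise the
    valuations of [u] are eventually equal to that of its class. Bounds over Q_p thus reduce to
    bounds over Q. *)
Lemma padic_val_geP (u : cauchy_seq p_pr) M :
  (M%:E <= padic_val (\pi_(padic p_pr) u))%E <->
  exists N, forall n, (N <= n)%N -> (M%:E <= rat_val p (\val u n))%E.
Proof.
have [u0|u0] := pselect (rat_null p (\val u)).
  by move/pi_eq0P/eqP: (u0) => ->; rewrite padic_val0 leey; split=> // _; apply: u0.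
have [v [N uv]] := cauchy_val_cst p_pr (asboolW (valP u)) u0.
rewrite (padic_val_pi uv); split=> [Mv|[K uK]]; first by exists N => n /uv ->.
by rewrite -(uv _ (leq_maxl N K)) uK // leq_maxr.
Qed.

Lemma padic_val_geD x y M : (M%:E <= padic_val x)%E ->
  (M%:E <= padic_val y)%E -> (M%:E <= padic_val (x + y)%R)%E.
Proof.
elim/quotW: x => u; elim/quotW: y => v; rewrite -rmorphD !padic_val_geP.
move=> [N uN] [K vK]; exists (maxn N K) => n; rewrite geq_max => /andP[Nn Kn].
by apply: (rat_valD p_pr); [apply: uN | apply: vK].
Qed.

Lemma padic_val_geM x y M K : (M%:E <= padic_val x)%E ->
  (K%:E <= padic_val y)%E -> ((M + K)%R%:E <= padic_val (x * y)%R)%E.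
Proof.
elim/quotW: x => u; elim/quotW: y => v; rewrite -rmorphM !padic_val_geP.
move=> [N uN] [N' vN]; exists (maxn N N') => n; rewrite geq_max => /andP[Nn Nn'].
rewrite -[\val _ n]/(\val u n * \val v n) (rat_valM p_pr) EFinD.
by apply: leeD; [apply: uN | apply: vN].
Qed.

Lemma padic_val_ge_eq0 x : (forall M, (M%:E <= padic_val x)%E) -> x = 0.
Proof.
by elim/quotW: x => u uM; apply/eqP/pi_eq0P => M; apply/padic_val_geP.
Qed.

Lemma rat_val_int_ge0 (c : int) : (0%:E <= rat_val p c%:~R)%E.
Proof.
have [->|c0] := eqVneq c 0; first by rewrite rat_val0 leey.
by rewrite -[c%:~R]divr1 (@rat_valE p p_pr _ 1) // logn1 subr0 lee_fin.
Qed.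

Lemma rat_val_pexp (n : nat) : rat_val p (p%:R ^+ n) = n%:Z%:E.
Proof.
elim: n => [|n IHn]; first by rewrite expr0 rat_val1.
have p0 := prime_gt0 p_pr.
rewrite exprS (rat_valM p_pr) IHn -[p%:R]divr1 (@rat_valE p p_pr p%:Z 1) ?absz_nat //.
  by rewrite logn1 subr0 logn_prime // eqxx -EFinD -PoszD.
by rewrite eqz_nat -lt0n.
Qed.

(** What remains after cancellation are terms c_n p^n with n >= 1 and c_n an integer. *)
Lemma digit_sum_tail (c : int -> int) (r : int) (m : nat) :
  (1%:E <= rat_val p (digit_sum p c r m%:Z - digit_sum p c r 0)%R)%E.
Proof.
pose F (k : nat) : rat := (c (k%:Z - r))%:~R * p%:R ^ (k%:Z - r).
have sumE (j : int) :
    digit_sum p c r j = \sum_(0 <= k < absz (Num.max 0 (j + r + 1))) F k.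
  by rewrite big_mkord.
rewrite !sumE.
set K := absz (Num.max 0 (0 + r + 1)).
rewrite (@big_cat_nat _ _ _ K) //=; last by rewrite /K; lia.
rewrite addrC addrK big_nat_cond.
apply: (big_ind (fun q => (1%:E <= rat_val p q)%E)) => [|q q'|k].
- by rewrite rat_val0 leey.
- exact: rat_valD.
rewrite andbT => /andP[Kk _]; rewrite /F (rat_valM p_pr).
(* K = max(0, r + 1), so k >= K forces k - r >= 1, also when r is negative. *)
have [j jE] : exists j : nat, k%:Z - r = j.+1%:Z.
  by exists (absz (k%:Z - r - 1)%R); move: Kk; rewrite /K; lia.
rewrite jE -exprnP rat_val_pexp -[X in (X%:E <= _)%E]add0r EFinD leeD //.
  exact: rat_val_int_ge0.
Qed.

Lemma padic_val_sub_floor (D : digit_system) x (q : rat) :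
  is_floor D x q -> (1%:E <= padic_val (x - padic_of_rat p_pr q)%R)%E.
Proof.
move=> [c [r [[_ cvg_x] ->]]]; have [N /(_ N (leqnn N)) xN] := cvg_x 1.
(* A partial sum within valuation 1 of [x] is inserted; it differs from the floor by a tail. *)
rewrite -(subrKA (padic_of_rat p_pr (digit_sum p c r N%:Z))).
apply: padic_val_geD => //.
by rewrite -rmorphB padic_val_rat digit_sum_tail.
Qed.

End PadicValTheory.

Theorem proposition31 (p : nat) (p_pr : prime p) (D : digit_system)
    (D_odd : D = BrowkinI -> odd p)
    (x y : rat) (x_neq0 : x != 0)
    (alpha : padic p_pr) (a : nat -> rat)
    (cf_alpha : infinite_cf_expansion D alpha a)
    (a0_val : (rat_val p (a 0%N) <= 0)%E)
    (a_val : forall n : nat, (1 <= n)%N -> (rat_val p (a n) < 0)%E)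
    (xs ys : nat -> rat)
    (xs0 : xs 0%N = x) (ys0 : ys 0%N = y)
    (xsS : forall n : nat, xs n.+1 = xs n * a n + ys n)
    (ysS : forall n : nat, ys n.+1 = xs n)
    (xs_val : forall n : nat,
      (rat_val p (xs n) + 1%:E <= rat_val p (xs n.+1))%E) :
  padic_of_rat p_pr x * alpha + padic_of_rat p_pr y = 0
  /\ alpha = padic_of_rat p_pr (- (y / x)).
Proof.
case: cf_alpha => al [al0 al_floor al_neq alS].
pose f : {rmorphism rat -> padic p_pr} := padic_of_rat p_pr; pose d n := al n - f (a n).
pose z n := f (xs n) * al n + f (ys n).
have d_val n : (1%:E <= padic_val (d n))%E := padic_val_sub_floor (al_floor n).
have zE n : z n = f (xs n.+1) + f (xs n) * d n.
  by rewrite /z /d xsS rmorphD rmorphM; ring.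
have zS n : z n = z n.+1 * d n.
  (* The expansion is infinite, so d_n is invertible and alpha_{n+1} d_n = 1. *)
  have d0 : d n != 0 by rewrite subr_eq0.
  by rewrite zE /z alS ysS mulrDl -mulrA mulVf // mulr1.
have [v xv] := rat_val_neq0 p x_neq0.
have xs_ge n : ((v + n%:Z)%:E <= rat_val p (xs n))%E.
  elim: n => [|n IHn]; first by rewrite xs0 xv addr0.
  apply: le_trans (xs_val n).
  by rewrite -addn1 PoszD addrA EFinD leeD.
have z_ge n : ((v + n%:Z + 1)%:E <= padic_val (z n))%E.
  (* Both summands reach the bound: x_n d_n gains 1 from d_n, and x_{n+1} from the growth of the
     x_n. *)
  rewrite zE; apply: padic_val_geD; last first.
    by apply: padic_val_geM => //; rewrite padic_val_rat.
  by rewrite padic_val_rat -addrA -PoszD addn1.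
(* Induction on [n] for all [m] at once replaces the explicit product of the d_i, since each step
   passes from z_m to z_{m+1}. *)
have z_shift n m : ((v + n%:Z + m%:Z + 1)%:E <= padic_val (z m))%E.
  elim: n m => [|n IHn] m; first by rewrite addr0.
  (* The added 0 lets the bound split into one for z_{m+1}, weaker by 1 than the induction
     hypothesis, and 0 + 1 for d_m. *)
  rewrite zS (_ : v + _ + _ + 1 = v + n%:Z + m.+1%:Z + 0%:Z + 1); last by lia.
  rewrite -addrA; apply: padic_val_geM => //.
  apply: le_trans (IHn _); rewrite lee_fin; lia.
have z0 : f x * alpha + f y = 0.
  rewrite -xs0 -ys0 -al0; apply: padic_val_ge_eq0 => M.
  (* The choice n = |M - v| gives v + n + 1 >= M. *)
  apply: le_trans (z_shift (absz (M - v)%R) 0%N); rewrite lee_fin; lia.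
split=> //.
have fx0 : f x != 0 by rewrite fmorph_eq0.
(* Multiplied by x, the claim becomes x alpha = -y. *)
apply: (mulfI fx0); rewrite -rmorphM mulrN mulrCA divff // mulr1.
by rewrite rmorphN; apply/eqP; rewrite -addr_eq0; apply/eqP.
Qed.
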